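(* Let $\mathbb{K}$ be an algebraically closed field of characteristic zero. Let $$P=\mathbb{Z}_{\geq 0}^3\setminus\left(\{(1,0,n)\mid n\in\mathbb{Z}_{\geq 0}\}\cup\{(0,1,m)\mid m\in\mathbb{Z}_{\geq 0}\}\right),$$ and let $X$ be the (nonnormal) affine toric variety corresponding to the monoid $P$, i.e. the irreducible affine variety with algebra of regular functions $$\mathbb{K}[X]=\bigoplus_{(a,b,c)\in P}\mathbb{K}\,x^ay^bz^c=\mathbb{K}[x^2,xy,y^2,x^3,x^2y,xy^2,y^3,z]\subset\mathbb{K}[x,y,z].$$ Then: (i) $\mathrm{ML}(X)=\mathbb{K}$; (ii) $\mathrm{ML}^*(X)=\mathbb{K}$; (iii) $\mathrm{HD}(X)=\mathbb{K}[X]$; (iv) $\mathrm{HD}^*(X)\neq\mathbb{K}[X]$.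
   Context: Let $X$ be an irreducible affine variety over $\mathbb{K}$ with algebra of regular functions $\mathbb{K}[X]$. A derivation of $\mathbb{K}[X]$ is a $\mathbb{K}$-linear map $\partial:\mathbb{K}[X]\to\mathbb{K}[X]$ with $\partial(fg)=f\partial(g)+g\partial(f)$. It is locally nilpotent (an LND) if for each $f\in\mathbb{K}[X]$ there is an integer $m>0$ with $\partial^m(f)=0$. $\mathrm{LND}(X)$ is the set of all locally nilpotent derivations of $\mathbb{K}[X]$. A slice of $\partial\in\mathrm{LND}(X)$ is an element $s\in\mathbb{K}[X]$ with $\partial(s)=1$; $\mathrm{LND}^*(X)$ is the set of all locally nilpotent derivations having a slice. The invariants are the following subalgebras of $\mathbb{K}[X]$ (the starred ones are considered when $\mathrm{LND}^*(X)\neq\emptyset$): - Makar-Limanov invariant: $\mathrm{ML}(X)=\bigcap_{\partial\in\mathrm{LND}(X)}\mathrm{Ker}\,\partial$; - modified Makar-Limanov invariant: $\mathrm{ML}^*(X)=\bigcap_{\partial\in\mathrm{LND}^*(X)}\mathrm{Ker}\,\partial$; - Derksen invariant: $\mathrm{HD}(X)$, the $\mathbb{K}$-subalgebra of $\mathbb{K}[X]$ generated by the kernels $\mathrm{Ker}\,\partial$ of all nonzero $\partial\in\mathrm{LND}(X)$; - modified Derksen invariant: $\mathrm{HD}^*(X)$, the $\mathbb{K}$-subalgebra of $\mathbb{K}[X]$ generated by the kernels $\mathrm{Ker}\,\partial$ of all $\partial\in\mathrm{LND}^*(X)$. *)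

(* Defs.v *)
From HB Require Import structures.
From mathcomp Require Import all_boot all_order all_algebra.
From mathcomp.multinomials Require Import mpoly.

Set Implicit Arguments.
Unset Strict Implicit.
Unset Printing Implicit Defensive.

Import GRing.Theory.
Local Open Scope ring_scope.

(* The invariants of X depend only on the K-algebra A = K[X].  Its subalgebras
   are Prop-valued predicates, since they quantify over all derivations of A. *)
Section Invariants.
Variables (K : fieldType) (A : comAlgType K).
Implicit Types (d : {linear A -> A}) (f g : A) (S G : A -> Prop).

Definition derivation d := forall f g, d (f * g) = f * d g + g * d f.

Definition LND d :=
  derivation d /\ forall f, exists m : nat, (0 < m)%N /\ iter m d f = 0.

Definition slice d (s : A) := d s = 1.

Definition LNDstar d := LND d /\ exists s, slice d s.

Definition is_subalgebra S :=
  [/\ S 1,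
      forall (c : K) f g, S f -> S g -> S (c *: f + g)
    & forall f g, S f -> S g -> S (f * g)].

Definition generated G f :=
  forall S, is_subalgebra S -> (forall g, G g -> S g) -> S f.

Definition ML f := forall d, LND d -> d f = 0.

Definition MLstar f := forall d, LNDstar d -> d f = 0.

Definition HD :=
  generated (fun f => exists d, [/\ LND d, ~ (forall g, d g = 0) & d f = 0]).

Definition HDstar := generated (fun f => exists d, LNDstar d /\ d f = 0).

Lemma generated_subalgebra G : is_subalgebra (generated G).
Proof.
split=> [S [] // | c f g Gf Gg S SA sGS | f g Gf Gg S SA sGS].
  by case: (SA) => _ SD _; apply: SD; [apply: Gf | apply: Gg].
by case: (SA) => _ _ SM; apply: SM; [apply: Gf | apply: Gg].
Qed.

End Invariants.

Arguments ML {K} A f.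
Arguments MLstar {K} A f.
Arguments HD {K} A f.
Arguments HDstar {K} A f.

(* A multinomial m : 'X_{1..3} is the exponent (m ix, m iy, m iz) of a monomial
   in x, y, z; the exponent of z is unconstrained in P. *)
Definition ix : 'I_3 := @Ordinal 3 0 isT.
Definition iy : 'I_3 := @Ordinal 3 1 isT.
Definition iz : 'I_3 := @Ordinal 3 2 isT.

Definition inP (m : 'X_{1..3}) : bool :=
  ((m ix, m iy) != (1, 0)%N) && ((m ix, m iy) != (0, 1)%N).

Lemma inP0 : inP 0%MM.
Proof. by rewrite /inP !mnm0E. Qed.

Lemma inPD m1 m2 : inP m1 -> inP m2 -> inP (m1 + m2)%MM.
Proof.
rewrite /inP !mnmDE !xpair_eqE.
by case: (m1 ix) (m1 iy) (m2 ix) (m2 iy)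
  => [|[|a]] [|[|b]] [|[|c]] [|[|e]].
Qed.

Section CoordinateRing.
Variable K : fieldType.

(* The span of the monomials with exponent in P, as a subalgebra of K[x,y,z]. *)
Definition KX_pred : {pred {mpoly K[3]}} := fun p => all inP (msupp p).

Lemma KX_predP p :
  reflect (forall m, m \in msupp p -> inP m) (p \in KX_pred).
Proof. exact: allP. Qed.

Lemma KX_subalg_closed : subalg_closed KX_pred.
Proof.
split=> [|c p q /KX_predP Pp /KX_predP Pq|p q /KX_predP Pp /KX_predP Pq];
  apply/KX_predP => m.
- by rewrite msupp1 inE => /eqP ->; apply: inP0.
- move/msuppD_le; rewrite mem_cat => /orP[/msuppZ_le|]; [exact: Pp|exact: Pq].
- by case/msuppM_le/allpairsP=> -[m1 m2] /= [h1 h2 ->]; apply: inPD; auto.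
Qed.

HB.instance Definition _ :=
  GRing.isSubalgClosed.Build K {mpoly K[3]} KX_pred KX_subalg_closed.

Record KX := MkKX { KX_val : {mpoly K[3]}; KX_valP : KX_val \in KX_pred }.

HB.instance Definition _ := [isSub for KX_val].
HB.instance Definition _ := [Choice of KX by <:].
HB.instance Definition _ := [SubChoice_isSubAlgebra of KX by <:].
HB.instance Definition _ := [SubNzRing_isSubComNzRing of KX by <:].

Lemma KX_val_lrmorphism (c : K) (f g : KX) :
  [/\ KX_val 1 = 1, KX_val (c *: f + g) = c *: KX_val f + KX_val g
    & KX_val (f * g) = KX_val f * KX_val g].
Proof. by []. Qed.

Lemma KX_domain (f g : KX) : f * g = 0 -> f = 0 \/ g = 0.
Proof.
move=> /(congr1 KX_val) /eqP; rewrite [_ == _]mulf_eq0.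
by case/orP => /eqP ?; [left | right]; apply: val_inj.
Qed.

Let x : {mpoly K[3]} := 'X_ix.
Let y : {mpoly K[3]} := 'X_iy.
Let z : {mpoly K[3]} := 'X_iz.

Definition KX_generators : seq {mpoly K[3]} :=
  [:: x ^+ 2; x * y; y ^+ 2; x ^+ 3; x ^+ 2 * y; x * y ^+ 2; y ^+ 3; z].

Let monomE (m : 'X_{1..3}) :
  'X_[m] = x ^+ m ix * y ^+ m iy * z ^+ m iz :> {mpoly K[3]}.
Proof.
rewrite mpolyXE_id !big_ord_recl big_ord0 mulr1 mulrA.
by congr (_ ^+ _ * _ ^+ _ * _ ^+ _); rewrite /x /y /z; try congr ('X_ _);
  try congr (m _); apply: val_inj.
Qed.

Let monom_KX a b c : ((a, b) != (1, 0)%N) && ((a, b) != (0, 1)%N) ->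
  x ^+ a * y ^+ b * z ^+ c \in KX_pred.
Proof.
move=> Pab; pose m := [multinom nth 0%N [:: a; b; c] i | i < 3].
have -> : x ^+ a * y ^+ b * z ^+ c = 'X_[m].
  by rewrite monomE !mnmE.
by rewrite unfold_in /KX_pred msuppX /= andbT /inP !mnmE.
Qed.

(* K[X] = K[x^2, xy, y^2, x^3, x^2y, xy^2, y^3, z]. *)
Lemma KX_generatedP (p : {mpoly K[3]}) :
  p \in KX_pred <-> generated (fun g => g \in KX_generators) p.
Proof.
split=> [/KX_predP Pp S [S1 SD SM] SG | ]; last first.
  move/(_ (fun q => q \in KX_pred)); apply=> [|g].
    by case: KX_subalg_closed.
  have h a b c := @monom_KX a b c.
  rewrite !inE; do ![case/orP]; move=> /eqP ->.
  - by have:= h 2 0 0 isT; rewrite !expr0 !mulr1.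
  - by have:= h 1 1 0 isT; rewrite !expr0 !mulr1.
  - by have:= h 0 2 0 isT; rewrite !expr0 mulr1 mul1r.
  - by have:= h 3 0 0 isT; rewrite !expr0 !mulr1.
  - by have:= h 2 1 0 isT; rewrite !expr0 !mulr1.
  - by have:= h 1 2 0 isT; rewrite !expr0 !mulr1.
  - by have:= h 0 3 0 isT; rewrite !expr0 mulr1 mul1r.
  - by have:= h 0 0 1 isT; rewrite !expr0 !mul1r.
have S0 : S 0 by rewrite -(addNr 1) -scaleN1r; apply: SD.
have Sz c : S (z ^+ c).
  elim: c => [|c IH]; first by rewrite expr0.
  by rewrite exprS; apply: SM => //; apply: SG; rewrite !inE eqxx !orbT.
have Sg g : g \in KX_generators -> S g by apply: SG.
have SX a : a != 1%N -> S (x ^+ a).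
  elim/ltn_ind: a => -[|[|[|[|a]]]] IH // _; try by apply: Sg; rewrite !inE eqxx ?orbT.
  by rewrite -(addn2 a.+2) exprD; apply: SM; [apply: IH | apply: Sg; rewrite !inE eqxx ?orbT].
have SY a : a != 1%N -> S (y ^+ a).
  elim/ltn_ind: a => -[|[|[|[|a]]]] IH // _; try by apply: Sg; rewrite !inE eqxx ?orbT.
  by rewrite -(addn2 a.+2) exprD; apply: SM; [apply: IH | apply: Sg; rewrite !inE eqxx ?orbT].
have SXY a b : ((a, b) != (1, 0)%N) && ((a, b) != (0, 1)%N) ->
    S (x ^+ a * y ^+ b).
  have [->|a1] := eqVneq a 1%N; last first.
    have [->|b1] := eqVneq b 1%N; last by move=> _; apply: SM; auto.
    case: a a1 => [|[|[|[|a]]]] // _ _; try by apply: Sg; rewrite !inE eqxx ?orbT.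
      by rewrite exprSr -mulrA; apply: SM; apply: Sg; rewrite !inE eqxx ?orbT.
    rewrite -(addn2 a.+2) exprD -mulrA; apply: SM; first exact: SX.
    by apply: Sg; rewrite !inE eqxx ?orbT.
  case: b => [|[|[|b]]] // _; try by apply: Sg; rewrite !inE eqxx ?orbT.
  case: b => [|b].
    by rewrite (exprS y 2) mulrA; apply: SM; apply: Sg; rewrite !inE eqxx ?orbT.
  rewrite -(add2n b.+2) exprD mulrA; apply: SM; last exact: SY.
  by apply: Sg; rewrite !inE eqxx ?orbT.
rewrite [p]mpolyE; elim: (msupp p) Pp => [|m s IH] Ps.
  by rewrite big_nil.
rewrite big_cons; apply: SD; last by apply: IH => m' ?; apply: Ps; rewrite inE orbC; apply/orP; left.
by rewrite monomE; apply: SM => //; apply: SXY; apply: Ps; rewrite inE eqxx.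
Qed.

End CoordinateRing.

(* Main.v *)
Require Import Defs.
From HB Require Import structures.
From mathcomp Require Import all_boot all_order all_algebra.
From mathcomp.multinomials Require Import mpoly.
From mathcomp Require Import ring.

(** Write A = K[X] and let M be the span of the monomials of A that involve x
    or y, that is, the kernel of the restriction [restr_z : A -> K[z]] to the
    line x = y = 0.

    The heart of the matter is part (iv): every derivation d of A, locally
    nilpotent or not, maps M into M ([derivation_restr_z_ker]).  On the
    fraction field dx = d(x^2) / 2x, so for f in M, where xf is again in A,
      2x d(xf) = 2x^2 df + f d(x^2)                    ([derivation_mulx]).
    Now A has no monomial x z^k, so no monomial x^2 z^k occurs on the left.
    On the right, x^2 z^k occurs in 2x^2 df with twice the coefficient of z^k
    in df, and in f d(x^2) only through the terms of f in x^2 K[z] and the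
    terms of d(x^2) in K[z].  For f = x^2 this gives 3 d(x^2) = 0 on the line,
    so d(x^2) is in M; then the same comparison gives df in M for every f.

    Hence d induces a derivation of A/M = K[z], which must be q |-> q' c with
    c the restriction of dz ([derivation_restr_z]).  If d has a slice then c
    is nonzero, so the kernel of d restricts to constants.  The functions with
    constant restriction to the line form a subalgebra, so this subalgebra
    contains HD^*, but it does not contain z.

    For the other parts it is enough to use the derivations
      c d/dz + e y^2 d/dx  and  c d/dz + e x^2 d/dy          ([shear_KX]).
    They preserve A, because every monomial divisible by x^2 or y^2 lies in A,
    they are locally nilpotent because the degree in the two variables being
    differentiated drops, and z is a slice when c = 1.  A function killed by
    all of those with c = 1 has zero partial derivatives, so ML^* = K, and a
    fortiori ML = K.  All the generators of A but z are killed by d/dz, and z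
    is killed by y^2 d/dx, so HD = A. *)

Set Implicit Arguments.
Unset Strict Implicit.
Unset Printing Implicit Defensive.

Import GRing.Theory.
Local Open Scope ring_scope.

(** * Derivations of an algebra *)

Section Derivation.
Variables (K : fieldType) (A : comAlgType K).

Lemma derivation1 (d : {linear A -> A}) : derivation d -> d 1 = 0.
Proof.
move=> dD; have := dD 1 1; rewrite !mul1r => d1.
by apply: (addIr (d 1)); rewrite add0r -d1.
Qed.

Lemma derivation_const (d : {linear A -> A}) c : derivation d -> d c%:A = 0.
Proof. by move=> dD; rewrite linearZ /= derivation1 ?scaler0. Qed.

Lemma ML_MLstar (f : A) : ML A f -> MLstar A f.
Proof. by move=> fML d [/fML]. Qed.

Lemma const_ML c : ML A c%:A.
Proof. by move=> d [dD _]; apply: derivation_const. Qed.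

End Derivation.

(** * Trinomial exponents and partial derivatives *)

Lemma ord3P (i : 'I_3) : [\/ i = ix, i = iy | i = iz].
Proof.
by case: i => -[|[|[|//]]] ?; [constructor 1|constructor 2|constructor 3];
  apply: val_inj.
Qed.

Definition mnm3 a b c : 'X_{1..3} := [multinom nth 0%N [:: a; b; c] i | i < 3].

Lemma mnm3_eqE a b c (m : 'X_{1..3}) :
  (m == mnm3 a b c) = [&& m ix == a, m iy == b & m iz == c].
Proof.
apply/eqP/and3P => [->|[/eqP ma /eqP mb /eqP mc]]; first by rewrite !mnmE.
by apply/mnmP => i; rewrite mnmE; case: (ord3P i) => ->.
Qed.

Section CoordinateRing.
Variable K : fieldType.
Hypothesis charK0 : [pchar K] =i pred0.

Lemma natf_neq0 n : n.+1%:R != 0 :> K.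
Proof. by rewrite ((pcharf0P K).1 charK0). Qed.

Lemma natp_neq0 n : n.+1%:R != 0 :> {poly K}.
Proof. by rewrite -polyC_natr polyC_eq0 natf_neq0. Qed.

Lemma mulrSn_eq0 (u : K) n : u *+ n.+1 = 0 -> u = 0.
Proof.
rewrite -mulr_natr => /eqP.
by rewrite mulf_eq0 (negPf (natf_neq0 n)) orbF => /eqP.
Qed.

Lemma deriv_eq0 (q : {poly K}) : q^`() = 0 -> q = (q`_0)%:P.
Proof.
move=> q0; apply/polyP => -[|i]; rewrite coefC //=.
by apply: (@mulrSn_eq0 _ i); rewrite -coef_deriv q0 coef0.
Qed.

Lemma mderiv_eq0 (p : {mpoly K[3]}) :
  (forall i, p^`M(i) = 0) -> p = (p@_0%MM)%:MP.
Proof.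
move=> dp; apply/mpolyP => m; rewrite mcoeffC.
have [<-|m0] := eqVneq 0%MM m; first by rewrite mulr1.
rewrite mulr0; have [i mi] : exists i, m i != 0%N.
  apply/existsP; apply: contraNT m0 => /existsPn m0.
  by apply/eqP/mnmP => i; rewrite mnm0E; have := m0 i; rewrite negbK => /eqP.
have := mcoeff_deriv i (m - U_(i))%MM p; rewrite dp mcoeff0 submK.
  by move/esym/mulrSn_eq0.
by rewrite lep1mP.
Qed.

Lemma msupp_mderiv i (p : {mpoly K[3]}) (m : 'X_{1..3}) :
  m \in msupp p^`M(i) -> (m + U_(i))%MM \in msupp p.
Proof.
by rewrite !mcoeff_msupp mcoeff_deriv; apply: contra_neq => ->; rewrite mul0rn.
Qed.

Lemma mpolyXi_neq0 (i : 'I_3) : 'X_i != 0 :> {mpoly K[3]}.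
Proof. by rewrite -msupp_eq0 msuppX. Qed.

(** * Restriction to the plane y = 0 and to the line x = y = 0 *)

Definition yzero_subst (i : 'I_3) : {poly {poly K}} :=
  if i == ix then 'X else if i == iy then 0 else 'X%:P.

(** The restriction to the plane y = 0 takes values in K[z][x], where x is the
    outer variable, so that the coefficient of index a is the factor in K[z]
    of x^a. *)
Definition restr_xz : {mpoly K[3]} -> {poly {poly K}} :=
  mmap (polyC \o polyC) yzero_subst.

HB.instance Definition _ := GRing.RMorphism.on restr_xz.

Lemma restr_xz_coef p a k : ((restr_xz p)`_a)`_k = p@_(mnm3 a 0 k).
Proof.
rewrite [in LHS](mpolyE p) [in RHS](mpolyE p) /restr_xz !raddf_sum !coef_sum.
apply: eq_bigr => m _; rewrite /= mmapZ mmapX mcoeffZ mcoeffX mnm3_eqE /=.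
rewrite !coefCM; congr (_ * _).
rewrite /mmap1 !big_ord_recl big_ord0 mulr1.
have -> : ord0 = ix :> 'I_3 by apply: val_inj.
have -> : lift ix ord0 = iy :> 'I_3 by apply: val_inj.
have -> : lift ix (lift ord0 ord0) = iz :> 'I_3 by apply: val_inj.
rewrite /yzero_subst /= expr0n -polyC_exp.
case: (m iy) => [|b] /=; last by rewrite mul0r mulr0 !coef0 andbF.
rewrite mul1r mulrC coefCM coefXn.
rewrite (eq_sym a); case: eqP => _ /=; last by rewrite mulr0 coef0.
by rewrite mulr1 coefXn eq_sym.
Qed.

Lemma restr_xz_x : restr_xz 'X_ix = 'X.
Proof. by rewrite /restr_xz mmapX mmap1U. Qed.

(** This is where the gap of the monoid at the exponents (1, 0, k) enters. *)
Lemma restr_xz_coef1 (f : KX K) : (restr_xz (KX_val f))`_1 = 0.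
Proof.
apply/polyP => k; rewrite coef0 restr_xz_coef; apply: memN_msupp_eq0.
by apply/negP => /(KX_predP _ (KX_valP f)); rewrite /inP !mnmE.
Qed.

Definition restr_z : KX K -> {poly K} := coefp 0 \o restr_xz \o val.

HB.instance Definition _ := GRing.RMorphism.on restr_z.

Lemma restr_zE f : restr_z f = (restr_xz (KX_val f))`_0.
Proof. by []. Qed.

Lemma restr_zZ c f : restr_z (c *: f) = c *: restr_z f.
Proof.
rewrite !restr_zE -[KX_val (c *: f)]/(c *: KX_val f) /restr_xz mmapZ /=.
by rewrite coefCM mul_polyC.
Qed.

(** * Elements of the coordinate ring *)

Lemma KX_pred_mulpow (i : 'I_3) n p :
  i != iz -> (1 < n)%N -> 'X_i ^+ n * p \in @KX_pred K.
Proof.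
move=> iNz n1; apply/KX_predP => m /msuppM_le /allpairsP[[m1 m2]] /=.
rewrite mpolyXn msuppX inE => -[/eqP -> _ ->].
rewrite /inP !mnmDE !mulmnE !mnm1E !xpair_eqE.
by case: (ord3P i) iNz => -> //= _; case: n n1 => [|[|n]] //= _; rewrite ?andbF.
Qed.

(** Multiplication by x reaches the missing exponents (1, 0, k) only from
    (0, 0, k), where the hypothesis makes the coefficient zero, and never
    reaches (0, 1, k). *)
Lemma KX_pred_mulx (f : KX K) :
  restr_z f = 0 -> 'X_ix * KX_val f \in @KX_pred K.
Proof.
rewrite restr_zE => f0; apply/KX_predP => m /msuppM_le /allpairsP[[m1 m2]] /=.
rewrite msuppX inE => -[/eqP -> m2f ->].
have := KX_predP _ (KX_valP f) _ m2f.
have: m2 != mnm3 0 0 (m2 iz).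
  by apply: contraTneq m2f => ->; rewrite -mcoeff_eq0 -restr_xz_coef f0 coef0.
rewrite mnm3_eqE eqxx andbT /inP !mnmDE !mnm1E !xpair_eqE /=.
by case: (m2 ix) (m2 iy) => [|a] [|b].
Qed.

Lemma KX_pred_z : 'X_iz \in @KX_pred K.
Proof.
by apply/KX_predP => m; rewrite msuppX inE => /eqP ->; rewrite /inP !mnm1E.
Qed.

(** The factor 1 lets [KX_pred_mulpow] be used as it stands. *)
Definition KX_x2 : KX K := MkKX (@KX_pred_mulpow ix 2 1 isT isT).
Definition KX_x3 : KX K := MkKX (@KX_pred_mulpow ix 3 1 isT isT).
Definition KX_z : KX K := MkKX KX_pred_z.

Lemma restr_z_z : restr_z KX_z = 'X.
Proof. by rewrite restr_zE /restr_xz /= mmapX mmap1U /= coefC. Qed.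

(** Polynomials in z form a section of the restriction to the line. *)
Lemma restr_z_horner (q : {poly K}) : restr_z (horner_alg KX_z q) = q.
Proof.
elim/poly_ind: q => [|q c IH]; first by rewrite !rmorph0.
rewrite !(rmorphD, rmorphM) /= horner_algX horner_algC IH restr_z_z.
by rewrite restr_zZ rmorph1 alg_polyC.
Qed.

(** * Derivations preserve the ideal of the line x = y = 0 *)

(** With g = xf, this is dg = x df + f dx, where dx = d(x^2) / 2x.  As x is not
    in the ring, it is derived from x^3 x^3 = x^2 x^2 x^2, which gives d(x^3)
    in terms of d(x^2), and from x^2 g = x^3 f, by cancelling powers of x in
    K[x,y,z]. *)
Lemma derivation_mulx (d : {linear KX K -> KX K}) (f g : KX K) :
  derivation d -> KX_val g = 'X_ix * KX_val f ->
  2%:R * 'X_ix * KX_val (d g) =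
  2%:R * 'X_ix ^+ 2 * KX_val (d f) + KX_val f * KX_val (d KX_x2).
Proof.
move=> dD; set x : {mpoly K[3]} := 'X_ix => gE.
have x0 : x != 0 by apply: mpolyXi_neq0.
have v2 : KX_val KX_x2 = x ^+ 2 by rewrite /= mulr1.
have v3 : KX_val KX_x3 = x ^+ 3 by rewrite /= mulr1.
have valD (a b : KX K) : KX_val (a + b) = KX_val a + KX_val b by [].
have valM (a b : KX K) : KX_val (a * b) = KX_val a * KX_val b by [].
have dx3 : 2%:R * KX_val (d KX_x3) = 3%:R * x * KX_val (d KX_x2).
  apply: (mulfI (expf_neq0 3 x0)).
  have : KX_x3 * KX_x3 = KX_x2 * (KX_x2 * KX_x2).
    by apply: val_inj; rewrite /= !mulr1; ring.
  move/(congr1 (fun h => KX_val (d h))).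
  rewrite !dD !(valD, valM) v2 v3 => e.
  transitivity (x ^+ 3 * KX_val (d KX_x3) + x ^+ 3 * KX_val (d KX_x3)).
    by ring.
  by rewrite e; ring.
apply: (mulfI x0).
have : KX_x2 * g = KX_x3 * f.
  by apply: val_inj; rewrite /= !mulr1 gE -/x; ring.
move/(congr1 (fun h => KX_val (d h))).
rewrite !dD !(valD, valM) v2 v3 gE => e.
transitivity
  (2%:R * (x ^+ 2 * KX_val (d g) + x * KX_val f * KX_val (d KX_x2))
   - 2%:R * x * KX_val f * KX_val (d KX_x2)); first by ring.
by rewrite e mulrDr (mulrCA 2%:R (KX_val f)) dx3; ring.
Qed.

(** The coefficient of x^2 in the identity [derivation_mulx] on the plane
    y = 0: it vanishes on the left, and the terms of f of degree 0 and 1 in x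
    vanish on the right. *)
Lemma derivation_mulx_coef (d : {linear KX K -> KX K}) (f : KX K) :
  derivation d -> restr_z f = 0 ->
  2%:R * restr_z (d f) + (restr_xz (KX_val f))`_2 * restr_z (d KX_x2) = 0.
Proof.
move=> dD f0; pose g := MkKX (KX_pred_mulx f0).
have f00 : (restr_xz (KX_val f))`_0 = 0 := f0; rewrite !restr_zE.
have := congr1 (fun p => (restr_xz p)`_2) (@derivation_mulx d f g dD erefl).
set x : {mpoly K[3]} := 'X_ix.
rewrite (rmorphD restr_xz) (rmorphM restr_xz (_ * x)).
rewrite (rmorphM restr_xz (_ * x ^+ 2)) (rmorphM restr_xz _ x).
rewrite (rmorphM restr_xz _ (x ^+ 2)) (rmorphM restr_xz (KX_val f)).
rewrite !(rmorph_nat restr_xz) (rmorphXn restr_xz) /= restr_xz_x.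
rewrite coefD -!mulrA !mulr_natl !coefMn coefXM /= restr_xz_coef1 mul0rn.
rewrite !coefXM /= => /esym.
by rewrite coefM !big_ord_recr big_ord0 /= f00 (restr_xz_coef1 f) !mul0r !add0r.
Qed.

Lemma derivation_restr_z_ker (d : {linear KX K -> KX K}) (f : KX K) :
  derivation d -> restr_z f = 0 -> restr_z (d f) = 0.
Proof.
move=> dD.
have dx2 : restr_z (d KX_x2) = 0.
  have := @derivation_mulx_coef d KX_x2 dD.
  rewrite restr_zE /= mulr1 rmorphXn /= restr_xz_x !coefXn /=.
  move/(_ erefl)/eqP; rewrite -mulrDl -(natrD _ 2 1).
  by rewrite mulf_eq0 (negPf (natp_neq0 _)) => /eqP.
move/(derivation_mulx_coef dD)/eqP.
by rewrite dx2 mulr0 addr0 mulf_eq0 (negPf (natp_neq0 _)) => /eqP.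
Qed.

(** * Kernels of derivations with a slice *)

(** The induced derivation of K[z] is determined by its value at z. *)
Lemma derivation_restr_z (d : {linear KX K -> KX K}) f : derivation d ->
  restr_z (d f) = (restr_z f)^`() * restr_z (d KX_z).
Proof.
move=> dD.
have dq q : restr_z (d (horner_alg KX_z q)) = q^`() * restr_z (d KX_z).
  elim/poly_ind: q => [|q c IH].
    by rewrite rmorph0 linear0 rmorph0 deriv0 mul0r.
  rewrite rmorphD rmorphM /= horner_algX horner_algC linearD /= dD.
  rewrite (derivation_const _ dD) addr0 rmorphD !rmorphM /= IH.
  rewrite restr_z_horner restr_z_z.
  by rewrite derivD derivM derivX derivC addr0 mulr1; ring.
have : restr_z (f - horner_alg KX_z (restr_z f)) = 0.
  by rewrite rmorphB /= restr_z_horner subrr.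
move/(derivation_restr_z_ker dD)/eqP.
by rewrite linearB rmorphB /= subr_eq0 dq => /eqP.
Qed.

Lemma LNDstar_ker_restr_z (d : {linear KX K -> KX K}) f :
  LNDstar d -> d f = 0 -> exists c, restr_z f = c%:P.
Proof.
case=> -[dD _] [s ds] df; exists (restr_z f)`_0; apply: deriv_eq0.
have := derivation_restr_z f dD; rewrite df rmorph0 => /esym/eqP.
rewrite mulf_eq0 => /orP[/eqP //|/eqP dz0].
have /eqP := derivation_restr_z s dD.
by rewrite ds rmorph1 dz0 mulr0 oner_eq0.
Qed.

Lemma HDstar_restr_z f : HDstar (KX K) f -> exists c, restr_z f = c%:P.
Proof.
move/(_ (fun g => exists c, restr_z g = c%:P)).
apply=> [|g [d [dS dg]]]; last exact: LNDstar_ker_restr_z dS dg.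
split=> [|c g h [a ga] [b hb]|g h [a ga] [b hb]].
- by exists 1; rewrite rmorph1.
- exists (c * a + b).
  by rewrite rmorphD /= restr_zZ ga hb -mul_polyC polyCD polyCM.
- by exists (a * b); rewrite rmorphM /= ga hb polyCM.
Qed.

Lemma KX_z_notin_HDstar : ~ HDstar (KX K) KX_z.
Proof.
case/HDstar_restr_z=> c; rewrite restr_z_z.
move/(congr1 (fun q : {poly K} => size q))/eqP.
by rewrite size_polyX size_polyC; case: (c == 0).
Qed.

(** * A family of locally nilpotent derivations *)

Definition pidx (b : bool) : 'I_3 := if b then ix else iy.

Section Shear.
Variables (c e : K) (b : bool).

(** c d/dz + e y^2 d/dx, or the same with x and y exchanged when b is false.
    With a square as coefficient, the second summand has all its exponents in
    the monoid whatever the partial derivative is. *)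
Definition shear (p : {mpoly K[3]}) : {mpoly K[3]} :=
  c *: p^`M(iz) + e *: ('X_(pidx (~~ b)) ^+ 2 * p^`M(pidx b)).

Lemma shear_is_linear : linear shear.
Proof.
by move=> a p q; rewrite /shear !linearP /= -!mul_mpolyC; ring.
Qed.

HB.instance Definition _ := GRing.isLinear.Build _ _ _ _ shear shear_is_linear.

Lemma shearM p q : shear (p * q) = p * shear q + q * shear p.
Proof. by rewrite /shear !mderivM -!mul_mpolyC; ring. Qed.

Lemma shear_KX_pred p : p \in @KX_pred K -> shear p \in @KX_pred K.
Proof.
move=> pP; rewrite rpredD ?rpredZ ?KX_pred_mulpow //; last by case: b.
apply/KX_predP => m /msupp_mderiv /(KX_predP _ pP).
by rewrite /inP !mnmDE !mnm1E !addn0.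
Qed.

Definition shear_KX (f : KX K) : KX K := MkKX (shear_KX_pred (KX_valP f)).

Lemma shear_KX_is_linear : linear shear_KX.
Proof. by move=> a f g; apply: val_inj; apply: shear_is_linear. Qed.

HB.instance Definition _ :=
  GRing.isLinear.Build _ _ _ _ shear_KX shear_KX_is_linear.

Definition shear_weight (m : 'X_{1..3}) := (m (pidx b) + m iz)%N.

Lemma shear_weight_lt n (p : {mpoly K[3]}) :
  {in msupp p, forall m, (shear_weight m < n.+1)%N} ->
  {in msupp (shear p), forall m, (shear_weight m < n)%N}.
Proof.
move=> wp m /msuppD_le; rewrite mem_cat => /orP[] /msuppZ_le.
  move/msupp_mderiv/wp; rewrite /shear_weight !mnmDE !mnm1E addnA addn1 ltnS.
  by apply: leq_trans; rewrite ltnS leq_add2r leq_addr.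
case/msuppM_le/allpairsP => -[m1 m2] /= [].
rewrite mpolyXn msuppX inE => /eqP -> /msupp_mderiv /wp /[swap] ->.
rewrite /shear_weight !mnmDE !mnm1E.
by case: b => /=; rewrite !add0n !addn0 addn1 addSn ltnS.
Qed.

Lemma shear_iter_eq0 n (p : {mpoly K[3]}) :
  {in msupp p, forall m, (shear_weight m < n)%N} -> iter n shear p = 0.
Proof.
elim: n p => [|n IH] p wp; last by rewrite iterSr IH //; apply: shear_weight_lt.
apply/eqP; rewrite -msupp_eq0; case: (msupp p) wp => // m s /(_ m).
by rewrite inE eqxx => /(_ isT).
Qed.

Lemma shear_KX_LND : LND shear_KX.
Proof.
split=> [f g|f]; first by apply: val_inj; apply: shearM.
have iterE k : KX_val (iter k shear_KX f) = iter k shear (KX_val f).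
  by elim: k => // k IH; rewrite !iterS -IH.
exists (\max_(m <- msupp (KX_val f)) shear_weight m).+1; split=> //.
apply: val_inj; rewrite [LHS]iterE.
by apply: shear_iter_eq0 => m mf; rewrite ltnS; apply: leq_bigmax_seq.
Qed.

End Shear.

Lemma shear_KX_slice e b : slice (shear_KX 1 e b) KX_z.
Proof.
apply: val_inj; rewrite /= /shear /= !mderivX !mnm1E /=.
case: b; rewrite /= scale0r mulr0 scaler0 addr0 !scale1r.
all: by rewrite -[X in (X - _)%MM]add0m addmK mpolyX0.
Qed.

Lemma shear_KX_LNDstar e b : LNDstar (shear_KX 1 e b).
Proof.
by split; [apply: shear_KX_LND | exists KX_z; apply: shear_KX_slice].
Qed.

(** * The invariants *)

Lemma MLstar_const f : MLstar (KX K) f -> exists c, f = c%:A.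
Proof.
move=> fML; exists (KX_val f)@_0%MM; apply: val_inj => /=.
have dz0 : (KX_val f)^`M(iz) = 0.
  have /(congr1 (@KX_val _)) := fML _ (shear_KX_LNDstar 0 true).
  by rewrite /= /shear scale1r scale0r addr0.
have dxy0 b : (KX_val f)^`M(pidx b) = 0.
  have /(congr1 (@KX_val _)) := fML _ (shear_KX_LNDstar 1 b).
  rewrite /= /shear dz0 scaler0 add0r scale1r => /eqP.
  by rewrite mulf_eq0 expf_eq0 /= (negPf (mpolyXi_neq0 _)) => /eqP.
rewrite {1}[KX_val f]mderiv_eq0; last first.
  move=> i; case: (ord3P i) => -> //; first exact: (dxy0 true).
  exact: (dxy0 false).
by rewrite -[1]mpolyC1 -mul_mpolyC mulr1.
Qed.

Lemma HD_full f : HD (KX K) f.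
Proof.
have [HD1 HDD HDM] := generated_subalgebra
  (fun f : KX K => exists d, [/\ LND d, ~ (forall g, d g = 0) & d f = 0]).
suff [g] : exists g, KX_val g = KX_val f /\ HD (KX K) g.
  by case=> /val_inj ->.
have := (KX_generatedP (KX_val f)).1 (KX_valP f).
move/(_ (fun p => exists g, KX_val g = p /\ HD (KX K) g)); apply=> [|p pg].
  split=> [|c p q [g [<- gH]] [h [<- hH]]|p q [g [<- gH]] [h [<- hH]]].
  - by exists 1.
  - by exists (c *: g + h); split=> //; apply: HDD.
  - by exists (g * h); split=> //; apply: HDM.
have pP : p \in @KX_pred K by apply/KX_generatedP => S _; apply.
exists (MkKX pP); split=> // S _; apply.
have [pz|pNz] := eqVneq p 'X_iz.
  exists (shear_KX 0 1 true); split; first exact: shear_KX_LND.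
  - move/(_ KX_x2)/(congr1 (@KX_val _))/eqP.
    rewrite /= /shear scale0r add0r scale1r mulr1.
    rewrite mulf_eq0 expf_eq0 /= (negPf (mpolyXi_neq0 _)) /=.
    rewrite mpolyXn mderivX scaler_eq0.
    rewrite -[_ == 0 :> {mpoly _[_]}]msupp_eq0 msuppX orbF.
    by rewrite mulmnE mnm1E (negPf (natf_neq0 _)).
  - apply: val_inj; rewrite /= /shear scale0r add0r pz mderivX mnm1E /=.
    by rewrite scale0r mulr0 scaler0.
exists (shear_KX 1 0 true); split; first exact: shear_KX_LND.
  by move/(_ KX_z); rewrite shear_KX_slice => /eqP; rewrite oner_eq0.
apply: val_inj; rewrite /= /shear scale0r addr0 scale1r.
move: pg; rewrite !inE (negPf pNz) orbF.
have dz i : i != iz -> ('X_i : {mpoly K[3]})^`M(iz) = 0.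
  by move=> iNz; rewrite mderivX mnm1E (negPf iNz) scale0r.
by do ![case/orP]; move/eqP=> ->; rewrite ?(exprS, expr0, mderivM) ?dz //
  ?mulr1 ?(mul0r, mulr0, addr0, mderivC).
Qed.

End CoordinateRing.

Theorem theorem2 (K : closedFieldType) (charK0 : [pchar K] =i pred0) :
  [/\ forall f : KX K, ML (KX K) f <-> exists c : K, f = c%:A,
      forall f : KX K, MLstar (KX K) f <-> exists c : K, f = c%:A,
      forall f : KX K, HD (KX K) f
    & ~ (forall f : KX K, HDstar (KX K) f)].
Proof.
split=> [f|f|f|HDstarT].
- split=> [/ML_MLstar|[c ->]]; first exact: MLstar_const.
  exact: const_ML.
- split=> [|[c ->]]; first exact: MLstar_const.
  exact/ML_MLstar/const_ML.
- exact: HD_full.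
- exact: (KX_z_notin_HDstar charK0 (HDstarT _)).
Qed.
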